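(* Let $0\le t_1<t_2<+\infty$, let $r:=\frac{t_2-t_1}2$ be the radius of the segment $[t_1,t_2]\subset\mathbb R^+$ and $t_0:=\frac{t_1+t_2}2$ its centre. Then for all $z$ in the closed upper half-plane $\overline{\mathbb C}^{\rm up}$ the following upper estimates hold: $$\omega(z,[t_1,t_2])\le\begin{cases}1&\text{for all } z\in D(t_0,r)\cup\{t_1\}\cup\{t_2\},\\[2pt] \frac12&\text{for all } z\in\mathbb C^{\rm up}\cap\partial D(t_0,r),\\[2pt] \dfrac1\pi\arctan\dfrac{2r|z-t_0|}{|z-t_0|^2-r^2}\ \le\ \dfrac{2r|z-t_0|}{\pi(|z-t_0|^2-r^2)}&\text{for } z\notin\overline D(t_0,r),\end{cases}\qquad z\in\overline{\mathbb C}^{\rm up},$$ and for each $t\in\mathbb R^+$ these estimates are sharp on each upper half-circle $\{z\in\overline{\mathbb C}^{\rm up}:|z-t_0|=t\}$. Moreover, for all $z\in\mathbb C^{\rm up}\cap D(t_0,r)$ the following lower estimate holds: $$\omega(z,[t_1,t_2])\ge1-\frac1\pi\arctan\frac{2r|z-t_0|}{r^2-|z-t_0|^2}\ge1-\frac1\pi\,\frac{2r|z-t_0|}{r^2-|z-t_0|^2}.$$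
   Context: $\mathbb R^+=[0,+\infty)$; $\mathbb C^{\rm up}=\{z\in\mathbb C:\operatorname{Im}z>0\}$, $\overline{\mathbb C}^{\rm up}=\{z\in\mathbb C:\operatorname{Im}z\ge0\}$; $D(t_0,r)$ and $\overline D(t_0,r)$ are the open and closed discs in $\mathbb C$ with centre $t_0$ and radius $r$. Harmonic measure of the upper half-plane: $\omega(z,B)=\frac1\pi\int_{B\cap\mathbb R}\frac{\operatorname{Im}z}{(t-\operatorname{Re}z)^2+(\operatorname{Im}z)^2}\,dt$ for $z\in\mathbb C^{\rm up}$ and Borel $B$; for real $x$, $\omega(x,B):=\delta_x(B)$ (Dirac measure at $x$). *)

(* Defs.v *)
From HB Require Import structures.
From mathcomp Require Import all_boot all_order all_algebra.
From mathcomp Require Import all_classical all_reals all_analysis.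
From mathcomp Require Import complex.
Import Order.TTheory GRing.Theory Num.Theory.
Import numFieldNormedType.Exports.
Set Implicit Arguments.
Unset Strict Implicit.
Unset Printing Implicit Defensive.

Local Open Scope complex_scope.
Local Open Scope classical_set_scope.
Local Open Scope ring_scope.

Definition upper_half (R : realType) : set R[i] := [set z | 0 < complex.Im z].

Definition closed_upper_half (R : realType) : set R[i] :=
  [set z | 0 <= complex.Im z].

(* The modulus as an element of R; `|z| is the same number seen in R[i]. *)
Definition modulus (R : realType) (z : R[i]) : R := complex.Re `|z|.

Definition disc (R : realType) (c : R[i]) (r : R) : set R[i] :=
  [set z | modulus (z - c) < r].

Definition closed_disc (R : realType) (c : R[i]) (r : R) : set R[i] :=
  [set z | modulus (z - c) <= r].

(* The boundary of disc c r when 0 < r. *)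
Definition circle (R : realType) (c : R[i]) (r : R) : set R[i] :=
  [set z | modulus (z - c) = r].

Definition segment (R : realType) (a b : R) : set R[i] :=
  [set t%:C | t in `[a, b]%classic].

Definition real_trace (R : realType) (B : set R[i]) : set R :=
  [set t : R | B t%:C].

Definition poisson_kernel (R : realType) (z : R[i]) (t : R) : R :=
  complex.Im z / ((t - complex.Re z) ^+ 2 + complex.Im z ^+ 2).

(* Harmonic measure of the upper half-plane, extended to the real axis by
   Dirac measures; the value is not meaningful when Im z < 0. *)
Definition harmonic_measure (R : realType) (z : R[i]) (B : set R[i]) : \bar R :=
  if 0 < complex.Im z then
    ((pi^-1)%:E *
      \int[lebesgue_measure]_(t in real_trace B) (poisson_kernel z t)%:E)%E
  else \d_(complex.Re z) (real_trace B).

(* Main.v *)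
Require Import Defs.
From mathcomp Require Import all_boot all_order all_algebra.
From mathcomp Require Import all_classical all_reals all_analysis.
From mathcomp Require Import complex ring lra.
Import Order.TTheory GRing.Theory Num.Theory.
Import numFieldNormedType.Exports.

Local Open Scope complex_scope.
Local Open Scope classical_set_scope.
Local Open Scope ring_scope.

(** The Poisson integral gives pi omega(z) = atan a - atan b with
    a = (t2 - x) / y and b = (t1 - x) / y for z = x + i y: this is the angle in
    ]0, pi[ under which the segment is seen from z.  Since
    1 + a b = (|z - t0|^2 - r^2) / y^2 and a - b = 2 r / y, the position of z
    relative to the circle decides whether the angle is acute, right or obtuse,
    and its tangent is 2 r y / (|z - t0|^2 - r^2).  All estimates then follow
    from y <= |z - t0|, with equality at z = t0 + i t. *)

(** * Differences of arctangents *)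

Lemma atan_le (R : realType) (x y : R) : x <= y -> atan x <= atan y.
Proof.
rewrite le_eqVlt => /predU1P[-> //|xy].
by apply/ltW/lt_atan.
Qed.

Lemma atan_ge0 (R : realType) (x : R) : 0 <= x -> 0 <= atan x.
Proof. by move=> x0; rewrite -[leLHS](atan0 R) atan_le. Qed.

(** By the mean value theorem [atan x] is [x] times a value of the derivative of [atan], and that
    derivative never exceeds 1. *)
Lemma atan_le_id (R : realType) (x : R) : 0 <= x -> atan x <= x.
Proof.
move=> x0.
have [c _] : exists2 c, c \in `[0, x]%R &
    atan x - atan 0 = (1 + c ^+ 2)^-1 * (x - 0).
  apply: (@MVT_segment R (@atan R) (fun c => (1 + c ^+ 2)^-1)) => //.
  by apply: continuous_subspaceT => c; exact: continuous_atan.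
rewrite atan0 !subr0 => ->; rewrite ler_piMl// invf_le1 ?lerDl ?sqr_ge0//.
by rewrite ltr_pwDl ?sqr_ge0.
Qed.

Lemma cos_atan_gt0 (R : realType) (x : R) : 0 < cos (atan x).
Proof. by rewrite cos_gt0_pihalf// atan_gtNpi2 atan_ltpi2. Qed.

(** Both cosines on the right are positive, so the sign of [1 + a * b] decides whether the angle
    [atan a - atan b] is acute, right or obtuse. *)
Lemma cos_atanB (R : realType) (a b : R) :
  cos (atan a - atan b) = cos (atan a) * cos (atan b) * (1 + a * b).
Proof.
have sin_atan (x : R) : sin (atan x) = x * cos (atan x).
  by rewrite -{2}(atanK x) /tan divfK// gt_eqF ?cos_atan_gt0.
by rewrite cosB !sin_atan; ring.
Qed.

Lemma atanB_bounds (R : realType) (a b : R) :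
  b < a -> 0 < atan a - atan b < pi.
Proof.
move=> ba; have := @lt_atan R _ _ ba; have := atan_ltpi2 a.
by have := atan_gtNpi2 b; lra.
Qed.

(** This covers [1 + a * b = 0] too: the angle then has cosine 0, and both sides are 0 because
    division by zero yields 0. *)
Lemma tan_atanB (R : realType) (a b : R) :
  tan (atan a - atan b) = (a - b) / (1 + a * b).
Proof.
rewrite -atanN tanD ?gt_eqF ?cos_atan_gt0// !atanK.
by rewrite mulrN opprK.
Qed.

Lemma atanB_pos (R : realType) (a b : R) : b < a -> 0 < 1 + a * b ->
  atan a - atan b = atan ((a - b) / (1 + a * b)).
Proof.
move=> /atanB_bounds/andP[d0 dpi] ab0.
rewrite -tan_atanB tanK// in_itv/=; apply/andP; split.
  by have := pi_gt0 R; lra.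
(* Cosine decreases on [0, pi], so being below pi / 2 amounts to having a positive cosine. *)
rewrite -ltr_cos ?in_itv/= ?cos_pihalf; first last.
- by have := pi_gt0 R; lra.
- by rewrite !ltW.
by rewrite cos_atanB !mulr_gt0 ?cos_atan_gt0.
Qed.

Lemma atanB_eq0 (R : realType) (a b : R) : b < a -> 1 + a * b = 0 ->
  atan a - atan b = pi / 2.
Proof.
move=> /atanB_bounds/andP[d0 dpi] ab0.
(* The tangent says nothing at a right angle; the cosine, injective on [0, pi], identifies it. *)
apply: cos_inj; rewrite ?in_itv/=.
- by rewrite !ltW.
- by have := pi_gt0 R; lra.
- by rewrite cos_pihalf cos_atanB ab0 mulr0.
Qed.

Lemma atanB_neg (R : realType) (a b : R) : b < a -> 1 + a * b < 0 ->
  atan a - atan b = pi - atan ((a - b) / - (1 + a * b)).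
Proof.
move=> /atanB_bounds/andP[d0 dpi] ab0.
(* The argument of [atan] is the tangent of the supplement of the angle. The angle being obtuse, its
   supplement is acute, so [atan] recovers it. *)
rewrite invrN mulrN -tan_atanB -tanN -(tanDpi (- _)) [- _ + pi]addrC.
rewrite tanK ?subKr// in_itv/=; apply/andP; split.
  by have := pi_gt0 R; lra.
suff : pi / 2 < atan a - atan b by lra.
rewrite -ltr_cos ?in_itv/= ?cos_pihalf; first last.
- by rewrite !ltW.
- by have := pi_gt0 R; lra.
by rewrite cos_atanB nmulr_llt0// mulr_gt0 ?cos_atan_gt0.
Qed.

(** * Evaluation of the Poisson integral over a segment *)

Lemma real_trace_segment (R : realType) (a b : R) :
  real_trace (segment a b) = `[a, b]%classic.
Proof.
apply/seteqP; split => t; rewrite /real_trace /segment /=.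
  by case=> u uab [<-].
by move=> tab; exists t.
Qed.

Lemma is_derive_atan_shift (R : realType) (z : R[i]) (t : R) :
  0 < complex.Im z ->
  is_derive t 1 (fun u => atan ((u - complex.Re z) / complex.Im z))
    (poisson_kernel z t).
Proof.
case: z => x y /= y0.
have D : is_derive t 1 (fun u => (u - x) / y) y^-1.
  have -> : (fun u => (u - x) / y) = (y^-1 \*: (id - cst x)).
    by apply/funext => u /=; rewrite mulrC.
  apply: is_derive_eq.
  by rewrite subr0 /GRing.scale /= mulr1.
have := @is_derive1_comp R (@atan R) (fun u => (u - x) / y) t _ _
  (is_derive1_atan ((t - x) / y)) D.
move=> /is_derive_eq; apply.
rewrite /poisson_kernel /=.
have y_neq0 : y != 0 by rewrite gt_eqF.
have -> : 1 + ((t - x) / y) ^+ 2 = ((t - x) ^+ 2 + y ^+ 2) / y ^+ 2 by field.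
by rewrite invf_div mulrAC expr2 mulfK.
Qed.

Lemma poisson_kernel_continuous (R : realType) (z : R[i]) :
  0 < complex.Im z -> continuous (poisson_kernel z).
Proof.
move=> y0 t; rewrite /poisson_kernel; apply: cvgM; first exact: cvg_cst.
apply: cvgV; first by rewrite gt_eqF// ltr_wpDl ?sqr_ge0// exprn_gt0.
apply: cvgD; last exact: cvg_cst.
apply: (@cvg_comp _ _ _ (fun t => t - complex.Re z) (fun u => u ^+ 2)).
  by apply: cvgB; [exact: cvg_id|exact: cvg_cst].
exact: exprn_continuous.
Qed.

(** The shifted and scaled arctangent [F] is a primitive of the Poisson kernel, so the fundamental
    theorem of calculus applies. *)
Lemma harmonic_measure_segment (R : realType) (z : R[i]) (a b : R) :
  0 < complex.Im z -> a < b ->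
  harmonic_measure z (segment a b) =
    (1 / pi * (atan ((b - complex.Re z) / complex.Im z)
               - atan ((a - complex.Re z) / complex.Im z)))%:E.
Proof.
move=> y0 ab; rewrite /harmonic_measure y0 real_trace_segment.
pose F t := atan ((t - complex.Re z) / complex.Im z).
have dF (t : R) : is_derive t 1 F (poisson_kernel z t).
  exact: is_derive_atan_shift.
have cF : continuous F.
  move=> t; apply/differentiable_continuous/derivable1_diffP.
  by case: (dF t).
rewrite (@continuous_FTC2 _ _ F)//.
- by rewrite -EFinB -EFinM div1r.
- exact/continuous_subspaceT/poisson_kernel_continuous.
- split; first by move=> t _; case: (dF t).
  + exact/cvg_at_right_filter/cF.
  + exact/cvg_at_left_filter/cF.
- by move=> t _; rewrite derive1E; apply: derive_val.
Qed.

Lemma harmonic_measure_real (R : realType) (x a b : R) :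
  harmonic_measure x%:C (segment a b) = ((x \in `[a, b])%:R)%:E.
Proof.
rewrite /harmonic_measure ltxx real_trace_segment diracE.
by rewrite mem_setE.
Qed.

(** * Distance to a real centre *)

Lemma modulusE (R : realType) (z : R[i]) :
  modulus z = Num.sqrt (complex.Re z ^+ 2 + complex.Im z ^+ 2).
Proof. by rewrite /modulus normc_def. Qed.

Lemma modulus_ge0 (R : realType) (z : R[i]) : 0 <= modulus z.
Proof. by rewrite modulusE sqrtr_ge0. Qed.

Lemma sqr_modulusB (R : realType) (z : R[i]) (c : R) :
  modulus (z - c%:C) ^+ 2 = (complex.Re z - c) ^+ 2 + complex.Im z ^+ 2.
Proof.
by case: z => x y; rewrite modulusE sqr_sqrtr ?addr_ge0 ?sqr_ge0//= subr0.
Qed.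

(** This is the only loss in passing from the exact arctangent formulas to the arctangent bounds; it
    vanishes directly above [c]. *)
Lemma Im_le_modulusB (R : realType) (z : R[i]) (c : R) :
  0 <= complex.Im z -> complex.Im z <= modulus (z - c%:C).
Proof.
move=> y0; rewrite -(@ler_pXn2r _ 2) ?nnegrE ?modulus_ge0//.
by rewrite sqr_modulusB lerDr sqr_ge0.
Qed.

Lemma modulus_realB (R : realType) (x c : R) :
  modulus (x%:C - c%:C) = `|x - c|.
Proof. by rewrite modulusE /= subr0 expr0n addr0 sqrtr_sqr. Qed.

Lemma modulus_imagD (R : realType) (c t : R) : 0 <= t ->
  modulus (Complex c t - c%:C) = t.
Proof.
by move=> t0; rewrite modulusE/= subrr subr0 expr0n add0r sqrtr_sqr ger0_norm.
Qed.

(** * Exact harmonic measure on, outside and inside the circle *)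

Section centred_segment.
Context {R : realType} (z : R[i]) (c r : R).
Hypotheses (z_upper : 0 < complex.Im z) (r_gt0 : 0 < r).
Let x := complex.Re z.
Let y := complex.Im z.
Let rho := modulus (z - c%:C).
Let a := (c + r - x) / y.
Let b := (c - r - x) / y.

Let y_neq0 : y != 0. Proof. by rewrite gt_eqF. Qed.

Let endpoints_lt : c - r < c + r.
Proof. by rewrite ltrD2l gtrN. Qed.

Let ltba : b < a. Proof. by rewrite /a /b ltr_pM2r ?invr_gt0// ltrD2r. Qed.

Let subab : a - b = 2 * r / y. Proof. by rewrite /a /b; field. Qed.

Let onePab : 1 + a * b = (rho ^+ 2 - r ^+ 2) / y ^+ 2.
Proof. by rewrite sqr_modulusB -/x -/y /a /b; field. Qed.

Let omegaE : harmonic_measure z (segment (c - r) (c + r)) =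
  (1 / pi * (atan a - atan b))%:E.
Proof. exact: harmonic_measure_segment. Qed.

Lemma harmonic_measure_lt1 :
  (harmonic_measure z (segment (c - r) (c + r)) < 1%:E)%E.
Proof.
have /andP[_ dpi] := atanB_bounds _ _ _ ltba.
by rewrite omegaE lte_fin div1r mulrC ltr_pdivrMr ?pi_gt0// mul1r.
Qed.

Lemma harmonic_measure_circle : rho = r ->
  harmonic_measure z (segment (c - r) (c + r)) = (1 / 2)%:E.
Proof.
move=> rhor; rewrite omegaE atanB_eq0 ?onePab ?rhor ?subrr ?mul0r//.
by rewrite mulrA divfK ?gt_eqF ?pi_gt0.
Qed.

Lemma harmonic_measure_exterior : r < rho ->
  harmonic_measure z (segment (c - r) (c + r)) =
    (1 / pi * atan (2 * r * y / (rho ^+ 2 - r ^+ 2)))%:E.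
Proof.
move=> rrho; have d0 : 0 < rho ^+ 2 - r ^+ 2.
  by rewrite subr_gt0 ltr_pXn2r ?nnegrE ?modulus_ge0// ltW.
rewrite omegaE atanB_pos ?onePab ?subab ?divr_gt0 ?exprn_gt0//.
by congr (EFin (_ * atan _)); field; rewrite y_neq0 gt_eqF.
Qed.

Lemma harmonic_measure_interior : rho < r ->
  harmonic_measure z (segment (c - r) (c + r)) =
    (1 - 1 / pi * atan (2 * r * y / (r ^+ 2 - rho ^+ 2)))%:E.
Proof.
move=> rhor; have d0 : 0 < r ^+ 2 - rho ^+ 2.
  by rewrite subr_gt0 ltr_pXn2r ?nnegrE ?modulus_ge0// ltW.
rewrite omegaE atanB_neg ?onePab ?subab//; last first.
  by rewrite pmulr_llt0 ?invr_gt0 ?exprn_gt0// -opprB oppr_lt0.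
rewrite mulrBr div1r mulVf ?gt_eqF ?pi_gt0//.
(* Both occurrences of the difference are written with the same positive [d], a single nonzero atom
   for [field]. *)
rewrite -[rho ^+ 2 - _]opprB; move: (r ^+ 2 - _) d0 => d d0.
by congr (EFin (_ - _ * atan _)); field; rewrite y_neq0 gt_eqF.
Qed.

End centred_segment.

Theorem mainTheorem13 (R : realType) (t1 t2 : R) (t1_ge0 : 0 <= t1)
    (t1_lt_t2 : t1 < t2) :
  let r : R := (t2 - t1) / 2 in
  let t0 : R := (t1 + t2) / 2 in
  let omega (z : R[i]) : \bar R := harmonic_measure z (segment t1 t2) in
  [/\ (* upper estimates *)
      forall z : R[i], closed_upper_half z ->
        let rho := modulus (z - t0%:C) in
        [/\ (disc t0%:C r `|` [set t1%:C] `|` [set t2%:C]) z ->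
              (omega z <= 1%:E)%E,
            (@upper_half R `&` circle t0%:C r) z ->
              (omega z <= (1 / 2)%:E)%E
          & ~ closed_disc t0%:C r z ->
              (omega z <=
                (1 / pi * atan (2 * r * rho / (rho ^+ 2 - r ^+ 2)))%:E)%E /\
              1 / pi * atan (2 * r * rho / (rho ^+ 2 - r ^+ 2)) <=
                2 * r * rho / (pi * (rho ^+ 2 - r ^+ 2))],
      (* sharpness on every upper half-circle *)
      forall t : R, 0 <= t ->
        let half_circle := @closed_upper_half R `&` circle t0%:C t in
        [/\ t < r -> exists2 z, half_circle z & omega z = 1%:E,
            t = r ->
              [/\ half_circle t1%:C /\ omega t1%:C = 1%:E,
                  half_circle t2%:C /\ omega t2%:C = 1%:E
                & exists2 z, (half_circle `&` @upper_half R) z &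
                             omega z = (1 / 2)%:E]
          & r < t -> exists2 z, half_circle z &
              omega z =
                (1 / pi * atan (2 * r * t / (t ^+ 2 - r ^+ 2)))%:E]
    & (* lower estimates *)
      forall z : R[i], (@upper_half R `&` disc t0%:C r) z ->
        let rho := modulus (z - t0%:C) in
        ((1 - 1 / pi * atan (2 * r * rho / (r ^+ 2 - rho ^+ 2)))%:E
           <= omega z)%E /\
        1 - 1 / pi * (2 * r * rho / (r ^+ 2 - rho ^+ 2)) <=
          1 - 1 / pi * atan (2 * r * rho / (r ^+ 2 - rho ^+ 2))].

Proof.
move=> r t0 omega.
have r_gt0 : 0 < r by rewrite /r; lra.
have r_ge0 := ltW r_gt0.
have t1E : t1 = t0 - r by rewrite /t0 /r; lra.
have t2E : t2 = t0 + r by rewrite /t0 /r; lra.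
(* From here on only the centred form of the endpoints and [0 < r] matter. *)
clearbody r t0.
have pi0 := pi_gt0 R.
have ipi0 : 0 <= 1 / pi :> R by rewrite divr_ge0 ?ltW.
have sqr_lt (u v : R) : 0 <= u -> u < v -> 0 < v ^+ 2 - u ^+ 2.
  by move=> u0 uv; rewrite subr_gt0 ltr_pXn2r ?nnegrE// (le_trans u0)// ltW.
have omega_real (x : R) : omega x%:C = (x \in `[t1, t2])%:R%:E.
  exact: harmonic_measure_real.
have t1_in : t1 \in `[t1, t2] by rewrite in_itv/= lexx ltW.
have t2_in : t2 \in `[t1, t2] by rewrite in_itv/= lexx ltW.
split.
- move=> [x y] y_ge0 rho.
  have rho_ge0 : 0 <= rho by exact: modulus_ge0.
  split.
  + move=> _; move: y_ge0; rewrite /closed_upper_half /= le_eqVlt.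
    case/predU1P => [<-|y0].
      by rewrite omega_real lee_fin lern1 leq_b1.
    by rewrite /omega t1E t2E ltW// harmonic_measure_lt1.
  + case=> y0 rhoE.
    by rewrite /omega t1E t2E harmonic_measure_circle.
  + move=> /negP; rewrite -ltNge => r_lt_rho.
    have d0 := sqr_lt _ _ r_ge0 r_lt_rho.
    have q0 : 0 <= 2 * r * rho / (rho ^+ 2 - r ^+ 2).
      by rewrite divr_ge0 ?mulr_ge0 ?(ltW d0).
    split; last first.
      by rewrite invfM mulrCA div1r ler_wpM2l ?atan_le_id ?invr_ge0 ?(ltW pi0).
    move: y_ge0; rewrite /closed_upper_half /= le_eqVlt.
    case/predU1P => [y0|y0].
      (* A real point outside the closed disc misses the segment, so its Dirac mass is 0 and the
         bound is nonnegative. *)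
      rewrite -y0 omega_real (_ : _ \in _ = false).
        by rewrite lee_fin mulr_ge0// atan_ge0.
      apply/negbTE; apply/negP; rewrite in_itv/= => /andP[x1 x2].
      move: r_lt_rho; rewrite ltNge => /negP; apply.
      by rewrite /rho -y0 modulus_realB ler_norml; lra.
    rewrite /omega t1E t2E harmonic_measure_exterior// lee_fin.
    (* The exact value has Im z where the bound has [rho], over the same positive denominator. *)
    rewrite ler_wpM2l// atan_le// ler_pM2r ?invr_gt0//.
    by rewrite ler_pM2l ?mulr_gt0// Im_le_modulusB// ltW.
- move=> t t_ge0 half_circle; split.
  (* A real endpoint of the half-circle lies in the segment, where the Dirac measure gives 1. *)
  + move=> t_lt_r; exists (t0 + t)%:C.
      split; first by rewrite /closed_upper_half/=.
      by rewrite /circle/= modulus_realB addrC addKr ger0_norm.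
    by rewrite omega_real in_itv/= (_ : _ && _ = true)//; lra.
  + move=> tr; split.
    * rewrite omega_real t1_in; split=> //; split.
        by rewrite /closed_upper_half/=.
      by rewrite /circle/= modulus_realB ler0_norm; lra.
    * rewrite omega_real t2_in; split=> //; split.
        by rewrite /closed_upper_half/=.
      by rewrite /circle/= modulus_realB ger0_norm; lra.
    * have t_gt0 : 0 < t by rewrite tr.
      exists (Complex t0 t).
        split=> //; split=> //.
        by rewrite /circle/= modulus_imagD.
      by rewrite /omega t1E t2E harmonic_measure_circle// modulus_imagD.
  + move=> r_lt_t; have t_gt0 : 0 < t by exact: lt_trans r_lt_t.
    (* At the top of the half-circle Im z equals [t], so the exact exterior value is the bound
       itself. *)
    exists (Complex t0 t).
      by split=> //; rewrite /circle/= modulus_imagD.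
    by rewrite /omega t1E t2E harmonic_measure_exterior// modulus_imagD.
- move=> z [y0 rho_lt_r] rho.
  have rho_ge0 : 0 <= rho by exact: modulus_ge0.
  have d0 := sqr_lt _ _ rho_ge0 rho_lt_r.
  split.
    rewrite /omega t1E t2E harmonic_measure_interior// lee_fin.
    (* Replacing Im z by [rho] enlarges the arctangent, which is subtracted here, hence a lower
       bound. *)
    rewrite lerB// ler_wpM2l// atan_le// ler_pM2r ?invr_gt0//.
    by rewrite ler_pM2l ?mulr_gt0// Im_le_modulusB// ltW.
  rewrite lerB// ler_wpM2l// atan_le_id//.
  by rewrite divr_ge0 ?mulr_ge0 ?(ltW d0).
Qed.
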